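(* Let $n,k\in\mathbb{N}$ with $n\equiv k\pmod 2$. Then there is a bijection between $\mathcal{C}_{\frac{n-k}{2},\frac{n+k}{2}}$ and $\mathcal{Z}_{n,k}^+$, and a bijection between $\mathcal{C}_{\frac{n-k}{2},\frac{n+k}{2}}$ and $\mathcal{Z}_{n,k}^-$.
   Context: A grand zigzag knight's path is a lattice path in $\mathbb{Z}^2$ starting at the origin, made of steps $N=(1,2)$, $\bar N=(1,-2)$, $E=(2,1)$, $\bar E=(2,-1)$, such that the vertical components of two consecutive steps never have the same direction (up-steps $N,E$ and down-steps $\bar N,\bar E$ alternate). The size is the $x$-coordinate and the altitude the $y$-coordinate of the last point. $\mathcal{Z}_{n,k}^+$ (resp. $\mathcal{Z}_{n,k}^-$) is the set of grand zigzag knight's paths of size $n$ and altitude $k$ starting with $E$ or $N$ (resp. with $\bar E$ or $\bar N$), with the convention that the empty path belongs to both $\mathcal{Z}_{0,0}^+$ and $\mathcal{Z}_{0,0}^-$. For integers $a,b$, $\mathcal{C}_{a,b}$ is the set of ordered pairs $(X,Y)$ where $X$ is a composition of $a$ and $Y$ a composition of $b$ with every part equal to $1$ or $2$ and such that $X$ and $Y$ have the same number of parts; the empty sequence is the unique composition of $0$, and $\mathcal{C}_{a,b}=\varnothing$ if $a<0$ or $b<0$. Here $\mathbb{N}$ includes $0$. *)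

(* Defs.v *)
(* Mathematical Components *)
From mathcomp Require Import all_boot all_order all_algebra.

Set Implicit Arguments.
Unset Strict Implicit.
Unset Printing Implicit Defensive.

Import GRing.Theory Num.Theory.
Local Open Scope ring_scope.

(* [Nbar] and [Ebar] are the down-steps, written with a bar over N and E. *)
Inductive step := N | Nbar | E | Ebar.

Definition step_vec (s : step) : int * int :=
  match s with
  | N    => (1, 2)
  | Nbar => (1, - 2)
  | E    => (2, 1)
  | Ebar => (2, - 1)
  end.

Definition up_step (s : step) : bool := 0 < (step_vec s).2.

(* A path starts at the origin, so it is determined by its list of steps. *)
Definition last_point (p : seq step) : int * int := \sum_(s <- p) step_vec s.
Definition path_size (p : seq step) : int := (last_point p).1.
Definition altitude (p : seq step) : int := (last_point p).2.

Definition grand_zigzag (p : seq step) : bool :=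
  sorted (fun s t => up_step s != up_step t) p.

(* In both predicates the empty path counts as having the required start; the
   conditions on size and altitude then admit it for (n, k) = (0, 0) only. *)
Definition starts_up (p : seq step) : bool :=
  match p with
  | [::] | E :: _ | N :: _ => true
  | _ => false
  end.

Definition starts_down (p : seq step) : bool :=
  match p with
  | [::] | Ebar :: _ | Nbar :: _ => true
  | _ => false
  end.

Definition Zplus (n : nat) (k : int) (p : seq step) : bool :=
  [&& grand_zigzag p, path_size p == n%:Z, altitude p == k & starts_up p].

Definition Zminus (n : nat) (k : int) (p : seq step) : bool :=
  [&& grand_zigzag p, path_size p == n%:Z, altitude p == k & starts_down p].

(* [a] is an integer; a negative [a] has no composition. *)
Definition composition (a : int) (X : seq nat) : bool :=
  all (fun i => 0 < i)%N X && ((sumn X)%:Z == a).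

Definition parts12 (X : seq nat) : bool :=
  all (fun i => (i == 1) || (i == 2))%N X.

Definition Cpairs (a b : int) (XY : seq nat * seq nat) : bool :=
  [&& composition a XY.1, composition b XY.2,
      parts12 XY.1, parts12 XY.2 & size XY.1 == size XY.2].

(* Main.v *)
(** The parities of size and altitude force the path to have even length,
    hence as many up-steps as down-steps.  Record the widths of the up-steps in
    [X] and those of the down-steps in [Y]: an up-step of width [w] rises by
    [3 - w] and a down-step of width [w] falls by [3 - w], so with equally many
    of both the size is [sumn X + sumn Y] and the altitude [sumn Y - sumn X].
    Since directions alternate, the path is recovered by interleaving. *)

Require Import Defs.
From mathcomp Require Import all_boot all_order all_algebra.
From mathcomp Require Import zify.

Set Implicit Arguments.
Unset Strict Implicit.
Unset Printing Implicit Defensive.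

(** Since [P] and [Q] are boolean, elements of the subtypes are equal as soon as their values are,
    so inverse laws on values suffice. *)
Lemma sig_bijective (A B : Type) (P : pred A) (Q : pred B)
    (f : A -> B) (g : B -> A) :
    (forall x, P x -> Q (f x)) -> (forall y, Q y -> P (g y)) ->
    (forall x, P x -> g (f x) = x) -> (forall y, Q y -> f (g y) = y) ->
  exists h : {x | P x} -> {y | Q y}, bijective h.
Proof.
move=> PQ QP fK gK.
exists (fun u => exist _ (f (val u)) (PQ _ (valP u))).
exists (fun v => exist _ (g (val v)) (QP _ (valP v))).
- by case=> x Px; apply: val_inj; apply: fK.
- by case=> y Qy; apply: val_inj; apply: gK.
Qed.

Definition width (s : step) : nat :=
  match s with N | Nbar => 1 | E | Ebar => 2 end.
(** Any value other than 1 is sent to the wide step, so [up] and [down] are right inverse to [width]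
    only on parts 1 and 2. *)
Definition up (w : nat) : step := if w == 1 then N else E.
Definition down (w : nat) : step := if w == 1 then Nbar else Ebar.

Lemma up_step_up w : up_step (up w).
Proof. by rewrite /up; case: ifP. Qed.

Lemma up_step_down w : up_step (down w) = false.
Proof. by rewrite /down; case: ifP. Qed.

Definition widths (p : seq step) : seq nat * seq nat :=
  ([seq width s | s <- p & up_step s], [seq width s | s <- p & ~~ up_step s]).

(** The flag [b] says whether each pair starts with its up-step. Excess entries of the longer list
    are dropped. *)
Fixpoint interleave (b : bool) (X Y : seq nat) : seq step :=
  match X, Y with
  | x :: X', y :: Y' =>
    if b then [:: up x, down y & interleave b X' Y']
    else [:: down y, up x & interleave b X' Y']
  | _, _ => [::]
  end.

(** Carrying the expected direction [b] merges zigzag and start conditions; after two steps [b]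
    returns, which suits induction by pairs. *)
Fixpoint alternates (b : bool) (p : seq step) : bool :=
  if p is s :: q then (up_step s == b) && alternates (~~ b) q else true.

Lemma alternates_cons s q :
  alternates (up_step s) (s :: q) = grand_zigzag (s :: q).
Proof.
rewrite /grand_zigzag /= eqxx /=.
elim: q s => //= t q IHq s; rewrite -IHq.
by case: (up_step s); case: (up_step t).
Qed.

Lemma alternatesE b p :
  alternates b p
    = grand_zigzag p && (if b then starts_up p else starts_down p).
Proof.
case: p => [|s q]; first by case: b.
by rewrite -alternates_cons; case: b; case: s; rewrite /= ?andbT ?andbF.
Qed.

Lemma interleave_alternates b X Y : alternates b (interleave b X Y).
Proof.
elim: X Y => [|x X IHX] [|y Y] //.
by case: b IHX => IHX; rewrite /= IHX up_step_up up_step_down.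
Qed.

Lemma interleaveK b X Y : parts12 X -> parts12 Y -> size X = size Y ->
  widths (interleave b X Y) = (X, Y).
Proof.
elim: X Y => [|x X IHX] [|y Y] //= /andP[hx hX] /andP[hy hY] [] sXY.
have width_up : width (up x) = x by case/orP: hx => /eqP->.
have width_down : width (down y) = y by case/orP: hy => /eqP->.
have [eX eY] := IHX Y hX hY sXY.
rewrite /widths; case: b {IHX} eX eY => eX eY;
  by rewrite /= up_step_up up_step_down /= width_up width_down eX eY.
Qed.

Lemma even_ind (T : Type) (P : seq T -> Prop) :
    P [::] -> (forall x y s, P s -> P [:: x, y & s]) ->
  forall s, ~~ odd (size s) -> P s.
Proof.
(* Induction on a bound [m] of the size, because the recursive call drops two elements at once. *)
move=> P0 PS s; move: {2}(size s) (leqnn (size s)) => m.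
elim: m s => [|m IHm] [|x [|y s]] //=; rewrite ltnS negbK => les os.
by apply: PS; apply: IHm => //; apply: ltnW.
Qed.

(** Each successive pair of steps contributes one up-step and one down-step. *)
Lemma size_widths b p : alternates b p -> ~~ odd (size p) ->
  size (widths p).1 = size (widths p).2.
Proof.
move=> + op; move: p op; apply: even_ind => // s t p IHp /=.
rewrite negbK; case/and3P=> /eqP-> /eqP-> /IHp {IHp} /=.
by case: b => /= ->.
Qed.

(** A step is determined by its direction and width, and [b] fixes both directions in every pair. *)
Lemma widthsK b p : alternates b p -> ~~ odd (size p) ->
  interleave b (widths p).1 (widths p).2 = p.
Proof.
move=> + op; move: p op; apply: even_ind => // s t p IHp.
rewrite /= negbK => /and3P[/eqP hs /eqP ht /IHp {}IHp].
by move: hs ht IHp; case: b; case: s => //; case: t => //= _ _ ->.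
Qed.

Lemma widths_parts12 p : parts12 (widths p).1 && parts12 (widths p).2.
Proof.
by elim: p => [|s p] //= /andP[h1 h2]; case: s => /=; rewrite h1 h2.
Qed.

Lemma parts12_gt0 X : parts12 X -> all (fun i => 0 < i) X.
Proof. by apply: sub_all => i /orP[] /eqP->. Qed.

Lemma size_widthsD p : size p = size (widths p).1 + size (widths p).2.
Proof. by rewrite /= !size_map !size_filter count_predC. Qed.

Lemma last_point_cons s p :
  last_point (s :: p)
    = ((step_vec s).1 + path_size p, (step_vec s).2 + altitude p)%R.
Proof. by rewrite /last_point big_cons. Qed.

Lemma path_size_widths p :
  path_size p = (sumn (widths p).1 + sumn (widths p).2)%N.
Proof.
elim: p => [|s p IHp]; first by rewrite /path_size /last_point big_nil.
rewrite {1}/path_size last_point_cons IHp.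
by case: s => /=; lia.
Qed.

(** Alternation is not assumed, so the difference of the two counts remains; its coefficient 3 being
    odd yields the parity argument below. *)
Lemma altitude_widths p :
  altitude p = (3 * ((size (widths p).1)%:Z - (size (widths p).2)%:Z)
                + (sumn (widths p).2)%:Z - (sumn (widths p).1)%:Z)%R.
Proof.
elim: p => [|s p IHp]; first by rewrite /altitude /last_point big_nil.
rewrite {1}/altitude last_point_cons IHp.
by case: s => /=; lia.
Qed.

Lemma compositions_zigzag_bij (b : bool) (n k : nat) (Z : pred (seq step)) :
    n = k %[mod 2] ->
    (forall p, Z p = [&& alternates b p, path_size p == n%:Z%R
                      & altitude p == k%:Z%R]) ->
  exists f : {XY : seq nat * seq nat |
                Cpairs ((n%:Z - k%:Z)%R %/ 2)%Z ((n%:Z + k%:Z)%R %/ 2)%Z XY} ->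
             {p : seq step | Z p},
    bijective f.
Proof.
move=> nk ZE.
(* With [u] up-steps and [d] down-steps, [n - k] is an even number minus [3 * (u - d)]; hence
   [u - d], and so [u + d], is even. *)
have even_size p : Z p -> ~~ odd (size p).
  rewrite ZE path_size_widths altitude_widths size_widthsD.
  by case/and3P=> _ /eqP np /eqP kp; lia.
apply: (@sig_bijective _ _ _ _ (fun XY => interleave b XY.1 XY.2) widths).
- case=> X Y /and5P[/andP[_ /eqP sX] /andP[_ /eqP sY] /= pX pY /eqP sXY].
  rewrite /= in sX sY sXY.
  rewrite ZE interleave_alternates path_size_widths altitude_widths.
  rewrite interleaveK //=.
  (* By [nk] both halvings are exact, so the sums of [X] and [Y] add up to [n] and differ by [k]. *)
  by apply/andP; split; apply/eqP; lia.
- move=> p Zp; move: (Zp); rewrite ZE => /and3P[ap /eqP np /eqP kp].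
  have eqs := size_widths ap (even_size p Zp).
  have /andP[p1 p2] := widths_parts12 p.
  rewrite path_size_widths in np; rewrite altitude_widths eqs in kp.
  rewrite /Cpairs /composition !parts12_gt0 // p1 p2 eqs eqxx /= andbT.
  (* With equal counts, [n - k] and [n + k] are twice the total widths of the up-steps and of the
     down-steps. *)
  by apply/andP; split; apply/eqP; move: np kp => /=; lia.
- by case=> X Y /and5P[_ _ pX pY /eqP sXY]; apply: interleaveK.
- move=> p Zp; apply: widthsK (even_size p Zp).
  by move: Zp; rewrite ZE => /and3P[].
Qed.

Theorem lemma3p2 (n k : nat) (hnk : n = k %[mod 2]) :
  (exists f : {XY : seq nat * seq nat |
                 Cpairs ((n%:Z - k%:Z)%R %/ 2)%Z ((n%:Z + k%:Z)%R %/ 2)%Z XY} ->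
              {p : seq step | Zplus n k%:Z p},
     bijective f)
  /\
  (exists f : {XY : seq nat * seq nat |
                 Cpairs ((n%:Z - k%:Z)%R %/ 2)%Z ((n%:Z + k%:Z)%R %/ 2)%Z XY} ->
              {p : seq step | Zminus n k%:Z p},
     bijective f).
Proof.
split; [apply: (compositions_zigzag_bij (b := true)) => // p
       |apply: (compositions_zigzag_bij (b := false)) => // p].
- by rewrite alternatesE /Zplus -!andbA; do !bool_congr.
- by rewrite alternatesE /Zminus -!andbA; do !bool_congr.
Qed.
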